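(* In the extra-special case, let $I$ be an upper ideal of $\Delta(1)$ and let $w_I\in W^0$ be an element with $\Delta(1)\setminus N(w_I)=I$. Then for $\gamma\in\Delta(1)$: (i) $\gamma\in\min(I)$ if and only if $w_I(\gamma)\in\Pi$, where, if $I$ is Lagrangian, $w_I$ is chosen so that $w_I(\theta)\in-\Delta^+$; (ii) $\gamma\in\max(\Delta(1)\setminus I)$ if and only if $w_I(\gamma)\in-\Pi$, where, if $I$ is Lagrangian, $w_I$ is chosen so that $w_I(\theta)\in\Delta^+$.
   Context: Let $\mathfrak g$ be a complex simple Lie algebra with root system $\Delta$ in a real Euclidean space with $W$-invariant inner product $(\,,\,)$, positive roots $\Delta^+$, simple roots $\Pi$, Weyl group $W$, highest root $\theta$, $\theta^\vee=2\theta/(\theta,\theta)$. Extra-special case: $\Delta(j)=\{\gamma\in\Delta:(\gamma,\theta^\vee)=j\}$, so $\Delta(2)=\{\theta\}$ and $\Delta^+=\Delta(0)^+\sqcup\Delta(1)\sqcup\{\theta\}$ with $\Delta(0)^+=\Delta(0)\cap\Delta^+$; $\Pi(0)=\Pi\cap\Delta(0)$. $\Delta(1)$ is partially ordered by $\mu\preccurlyeq\gamma$ iff $\gamma-\mu$ is a nonnegative integer combination of $\Pi(0)$; $\min$, $\max$ denote sets of minimal/maximal elements. $W^0=\{w\in W:w(\alpha)\in\Delta^+\ \forall\alpha\in\Delta(0)^+\}$; $N(w)=\{\gamma\in\Delta^+:w(\gamma)\in-\Delta^+\}$. Every upper ideal $I$ of $\Delta(1)$ equals $\Delta(1)\setminus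 N(w)$ for one element $w\in W^0$, or for exactly two elements $w,ws_\theta$ (with $w(\theta)=-ws_\theta(\theta)$) when $I$ is Lagrangian. A subset $S\subset\Delta(1)$ is Lagrangian if $\#S=\frac12\#\Delta(1)$ and no $\gamma_1,\gamma_2\in S$ satisfy $\gamma_1+\gamma_2=\theta$. *)

(* Defs.v *)
From mathcomp Require Import all_boot all_order all_algebra.
From mathcomp Require Import finmap.
From mathcomp Require Import boolp classical_sets functions cardinality reals.

Set Implicit Arguments.
Unset Strict Implicit.
Unset Printing Implicit Defensive.

Import Order.TTheory GRing.Theory Num.Theory.
Local Open Scope ring_scope.
Local Open Scope classical_set_scope.

(* The root systems of the complex simple Lie algebras are exactly the
   irreducible reduced crystallographic root systems in real Euclidean spaces.
   A Euclidean space is a finite-dimensional real vector space V with a positive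
   definite symmetric bilinear form ip : {dot V for idfun}.  The reflections are
   taken with respect to ip, so that ip is W-invariant. *)

Section RootSystem.
Variables (R : realType) (V : vectType R) (ip : {dot V for idfun}).
Implicit Types (Delta Pi S A I : set V) (theta : V) (w : V -> V).

Definition coroot (a : V) : V := (2 / ip a a) *: a.

Definition reflection (a v : V) : V := v - ip v (coroot a) *: a.

Record root_system Delta : Prop := RootSystem {
  root_finite : finite_set Delta;
  root_neq0 : ~ Delta 0;
  root_span : <<fset_set Delta>>%VS = fullv;
  root_reflection : forall a b, Delta a -> Delta b -> Delta (reflection a b);
  root_integral : forall a b, Delta a -> Delta b ->
    ip b (coroot a) \is a Num.int;
  root_reduced : forall a (c : R), Delta a -> Delta (c *: a) ->
    c = 1 \/ c = -1 }.

Definition irreducible Delta : Prop :=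
  Delta !=set0 /\
  forall A B : set V, A `|` B = Delta ->
    (forall a b, A a -> B b -> ip a b = 0) -> A = set0 \/ B = set0.

(* The reflections are involutions, so the monoid they generate is a group. *)
Inductive weyl Delta : (V -> V) -> Prop :=
| weyl_id : weyl Delta id
| weyl_comp a w : Delta a -> weyl Delta w ->
    weyl Delta (reflection a \o w).

(* Nonnegative integer combinations of a finite set S. *)
Definition nat_span S : set V :=
  [set v | exists c : V -> nat, v = \sum_(a <- fset_set S) a *+ c a].

Definition opp_set S : set V := [set - v | v in S].

(* The positive system is the one determined by Pi, see pos_roots. *)
Record simple_roots Delta Pi : Prop := SimpleRoots {
  simple_root : Pi `<=` Delta;
  simple_basis : basis_of fullv (fset_set Pi);
  simple_sign : Delta `<=` nat_span Pi `|` opp_set (nat_span Pi) }.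

Definition pos_roots Delta Pi : set V := Delta `&` nat_span Pi.

Definition highest_root Delta Pi theta : Prop :=
  Delta theta /\ forall a, Delta a -> nat_span Pi (theta - a).

(* Delta(j) *)
Definition graded Delta theta (j : int) : set V :=
  [set a | Delta a /\ ip a (coroot theta) = j%:~R].

(* The partial order on Delta(1). *)
Definition root_le Delta Pi theta (mu gamma : V) : Prop :=
  nat_span (Pi `&` graded Delta theta 0) (gamma - mu).

Definition minimals Delta Pi theta S : set V :=
  [set a | S a /\ forall b, S b -> root_le Delta Pi theta b a -> b = a].

Definition maximals Delta Pi theta S : set V :=
  [set a | S a /\ forall b, S b -> root_le Delta Pi theta a b -> b = a].

Definition upper_ideal Delta Pi theta I : Prop :=
  I `<=` graded Delta theta 1 /\
  forall mu gamma, I mu -> graded Delta theta 1 gamma ->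
    root_le Delta Pi theta mu gamma -> I gamma.

Definition lagrangian Delta theta S : Prop :=
  [/\ S `<=` graded Delta theta 1,
      (#|` fset_set S|.*2 = #|` fset_set (graded Delta theta 1)|)%N
    & forall a b, S a -> S b -> a + b <> theta].

(* W^0 *)
Definition weyl0 Delta Pi theta w : Prop :=
  weyl Delta w /\
  forall a, (graded Delta theta 0 `&` pos_roots Delta Pi) a ->
    pos_roots Delta Pi (w a).

(* N(w) *)
Definition inversions Delta Pi w : set V :=
  [set a | pos_roots Delta Pi a /\
    opp_set (pos_roots Delta Pi) (w a)].

End RootSystem.

(* Main.v *)
Require Import Defs.
From HB Require Import structures.
From mathcomp Require Import all_boot all_order all_algebra.
From mathcomp Require Import finmap zify ring lra.
From mathcomp Require Import boolp classical_sets functions cardinality reals.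

Set Implicit Arguments.
Unset Strict Implicit.
Unset Printing Implicit Defensive.

Import Order.TTheory GRing.Theory Num.Theory.
Local Open Scope ring_scope.
Local Open Scope classical_set_scope.

(** If [w gamma] is positive but not simple, it is a sum of two positive roots;
    pulling this back by [w] writes [gamma] in [Delta(1)] as a sum of two roots.
    Either the degrees are 1 and 0, and then [gamma] is not minimal in [I], or
    [gamma = theta + (gamma - theta)] with [w theta] positive.  In the latter case
    [I] is not Lagrangian and contains some pair [nu, theta - nu].  As
    [(gamma, nu) + (gamma, theta - nu) = (gamma, theta) > 0], one of [gamma - nu],
    [gamma - (theta - nu)] is a root of degree 0, which is seen to be positive, so
    again [gamma] is not minimal.  Part (ii) is part (i) for [w s_theta] and
    [theta - gamma]. *)

(** * Nonnegative integer combinations *)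

Section NatSpan.
Variables (R : realType) (V : vectType R).
Implicit Types (S : set V) (h : {additive V -> R}).

(** No finiteness is assumed: for infinite [S] the default value of [fset_set S] is empty. *)
Lemma fset_set_subset S a : a \in fset_set S -> S a.
Proof.
case: (pselect (finite_set S)) => [fS|nfS]; first by rewrite in_fset_set // inE.
by rewrite /fset_set; case: pselect.
Qed.

Lemma nat_span0 S : nat_span S 0.
Proof. by exists (fun=> 0%N); rewrite big1. Qed.

Lemma nat_spanD S x y : nat_span S x -> nat_span S y -> nat_span S (x + y).
Proof.
move=> [c ->] [d ->]; exists (fun a => c a + d a)%N.
by rewrite -big_split /=; apply: eq_bigr => a _; rewrite mulrnDr.
Qed.

Lemma nat_spanMn S x n : nat_span S x -> nat_span S (x *+ n).
Proof.
move=> Sx; elim: n => [|n IHn]; first by rewrite mulr0n; exact: nat_span0.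
by rewrite mulrS; apply: nat_spanD.
Qed.

Lemma nat_span_sum S (J : Type) (r : seq J) (P : pred J) (F : J -> V) :
  (forall i, P i -> nat_span S (F i)) -> nat_span S (\sum_(i <- r | P i) F i).
Proof.
move=> SF; elim/big_ind : _ => //; [exact: nat_span0 | by move=> *; apply: nat_spanD].
Qed.

Lemma mem_nat_span S a : finite_set S -> S a -> nat_span S a.
Proof.
move=> fS Sa; exists (fun b => (b == a)%N).
have aS : a \in fset_set S by rewrite in_fset_set // inE.
by rewrite (bigD1_seq a) ?fset_uniq //= eqxx mulr1n big1 ?addr0 // => b /negbTE ->; rewrite mulr0n.
Qed.

Lemma nat_span_ge0 S h x :
  (forall a, S a -> 0 <= h a) -> nat_span S x -> 0 <= h x.
Proof.
move=> h0 [c ->]; rewrite raddf_sum big_seq; apply: sumr_ge0 => a /fset_set_subset Sa.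
by rewrite raddfMn mulrn_wge0 // h0.
Qed.

(** The terms of [h x] are nonnegative and add up to 0, so each vanishes: an [a] with [h a] nonzero
    has coefficient 0. *)
Lemma nat_span_face S h x : finite_set S ->
  (forall a, S a -> 0 <= h a) -> nat_span S x -> h x = 0 ->
  nat_span (S `&` [set a | h a = 0]) x.
Proof.
move=> fS h0 [c xE]; rewrite xE raddf_sum => hx.
have hcE a : a \in fset_set S -> h (a *+ c a) = 0.
  move=> aS; apply/eqP; rewrite big_seq in hx.
  move/eqP: hx; rewrite psumr_eq0 => [/allP/(_ a aS)|b /fset_set_subset Sb].
    by rewrite aS.
  by rewrite raddfMn mulrn_wge0 // h0.
rewrite big_seq; apply: nat_span_sum => a aS.
have := hcE _ aS; rewrite raddfMn => /eqP; rewrite mulrn_eq0.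
case/orP=> [/eqP ->|/eqP ha0]; first by rewrite mulr0n; exact: nat_span0.
apply/nat_spanMn/mem_nat_span; first exact: finite_setIl.
by split=> //; exact: fset_set_subset.
Qed.

End NatSpan.

(** * The inner product, coroots and reflections *)

Section Reflections.
Variables (R : realType) (V : vectType R) (ip : {dot V for idfun}).
Implicit Types a b u v : V.

Lemma ipC u v : ip u v = ip v u.
Proof. by rewrite hermC expr0 mul1r. Qed.

Lemma ip_gt0 u : u != 0 -> 0 < ip u u.
Proof. exact: neq0_dnorm_gt0. Qed.

Lemma ipZr u v c : ip u (c *: v) = c * ip u v.
Proof. by rewrite linearZr_LR. Qed.

Lemma ipZl u v c : ip (c *: u) v = c * ip u v.
Proof. by rewrite ipC ipZr ipC. Qed.

Lemma ip_coroot u a : ip u (coroot ip a) = 2 * ip u a / ip a a.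
Proof. by rewrite ipZr mulrAC. Qed.

Lemma ip_coroot_self a : a != 0 -> ip a (coroot ip a) = 2.
Proof. by move=> /ip_gt0 ?; rewrite ip_coroot; field; lra. Qed.

Lemma reflectionD a u v :
  reflection ip a (u + v) = reflection ip a u + reflection ip a v.
Proof. by rewrite /reflection linearDl scalerDl opprD addrACA. Qed.

Lemma reflection_self a : a != 0 -> reflection ip a a = - a.
Proof. by move=> ?; rewrite /reflection ip_coroot_self // scaler_nat mulr2n opprD addNKr. Qed.

Lemma reflectionK a : a != 0 -> involutive (reflection ip a).
Proof.
move=> a0 v; rewrite {1}/reflection {2}/reflection linearBl /= ipZl ip_coroot_self //.
rewrite /reflection -addrA -opprD -scalerDl.
by rewrite (_ : ip v _ + _ = 0) ?scale0r ?subr0 //; ring.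
Qed.

End Reflections.

(** * Differences of roots and the Weyl group action *)

Section Roots.
Variables (R : realType) (V : vectType R) (ip : {dot V for idfun}).
Variable Delta : set V.
Hypothesis rsD : root_system ip Delta.
Implicit Types (a b : V) (w : V -> V).

Lemma root_nz a : Delta a -> a != 0.
Proof. by move=> Da; apply/eqP => a0; apply: (root_neq0 rsD); rewrite -a0. Qed.

Lemma rootN a : Delta a -> Delta (- a).
Proof.
move=> Da; rewrite -(reflection_self ip (root_nz Da)).
exact: (root_reflection rsD).
Qed.

(* Both Cartan integers are positive and, by Cauchy-Schwarz, their product is
   less than 4, so one of them is 1 and the matching reflection gives a - b. *)
Lemma rootB a b : Delta a -> Delta b -> 0 < ip a b -> a != b -> Delta (a - b).
Proof.
move=> Da Db ab0 neq_ab.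
have a0 := ip_gt0 ip (root_nz Da); have b0 := ip_gt0 ip (root_nz Db).
(* This is the component of [a] orthogonal to [b]. Were it 0, reducedness would force [a = b] or
   [a = - b], and the latter contradicts [0 < ip a b]. Its positive norm gives the strict
   Cauchy-Schwarz inequality. *)
have q0 : a - (ip a b / ip b b) *: b != 0.
  rewrite subr_eq0; apply: contra neq_ab => /eqP aE.
  have := Da; rewrite {1}aE => /(root_reduced rsD Db)[cE|cE].
    by rewrite aE cE scale1r.
  by have := divr_gt0 ab0 b0; rewrite cE oppr_gt0 ltr10.
have := ip_gt0 ip q0; rewrite linearBl !linearBr /= !ipZl !ipZr (ipC ip b a).
have -> : ip a a - ip a b / ip b b * ip a b -
  (ip a b / ip b b * ip a b - ip a b / ip b b * (ip a b / ip b b * ip b b))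
  = ip a a - ip a b ^+ 2 / ip b b by field; lra.
rewrite subr_gt0 ltr_pdivrMr // => CS.
have /intrP[m mE] := root_integral rsD Db Da.
have /intrP[n nE] := root_integral rsD Da Db.
have m0 : 0 < m by rewrite -(ltr0z R) -mE ip_coroot divr_gt0 ?mulr_gt0.
have n0 : 0 < n by rewrite -(ltr0z R) -nE ip_coroot divr_gt0 ?mulr_gt0 // ipC.
have mn4 : m * n < 4.
  rewrite -(ltr_int R) intrM -nE -mE !ip_coroot (ipC ip a b).
  rewrite mulrACA -invfM ltr_pdivrMr ?mulr_gt0 //.
  by move: CS; rewrite (ipC ip b a); nra.
have [m1|n1] : m = 1 \/ n = 1 by nia.
  have := root_reflection rsD Db Da.
  by rewrite /reflection mE m1 mulr1z scale1r.
have := rootN (root_reflection rsD Da Db).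
by rewrite /reflection nE n1 mulr1z scale1r opprB.
Qed.

Lemma weylD w u v : weyl ip Delta w -> w (u + v) = w u + w v.
Proof. by elim=> [//|a f Da _ /= ->]; rewrite reflectionD. Qed.

Lemma weyl0E w : weyl ip Delta w -> w 0 = 0.
Proof. by move=> Ww; apply: (addrI (w 0)); rewrite -weylD // !addr0. Qed.

Lemma weylN w u : weyl ip Delta w -> w (- u) = - w u.
Proof. by move=> Ww; apply: (addrI (w u)); rewrite -weylD // !subrr weyl0E. Qed.

Lemma weylB w u v : weyl ip Delta w -> w (u - v) = w u - w v.
Proof. by move=> Ww; rewrite weylD // weylN. Qed.

Lemma weyl_inj w : weyl ip Delta w -> injective w.
Proof.
elim=> [|a f Da _ finj]; first exact: inj_id.
by move=> u v /= /(inv_inj (reflectionK ip (root_nz Da)))/finj.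
Qed.

Lemma weyl_root w a : weyl ip Delta w -> Delta a -> Delta (w a).
Proof. by move=> Ww Da; elim: Ww => //= b f Db _ Dfa; apply: (root_reflection rsD). Qed.

Lemma weyl_root_preimage w b : weyl ip Delta w -> Delta b ->
  exists2 a, Delta a & w a = b.
Proof.
move=> Ww; elim: Ww b => [|c f Dc _ IH] b Db; first by exists b.
have [a Da fa] := IH _ (root_reflection rsD Dc Db).
by exists a => //=; rewrite fa reflectionK // root_nz.
Qed.

(** [weyl] builds words by adding reflections on the left, so adding one on the right takes an
    induction. *)
Lemma weyl_comp_reflection w a : Delta a -> weyl ip Delta w ->
  weyl ip Delta (w \o reflection ip a).
Proof.
move=> Da; elim=> [|b f Db _ IH]; last exact: (weyl_comp Db IH).
exact: (weyl_comp Da (weyl_id _ _)).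
Qed.

End Roots.

(** * Height, positive roots and simple roots *)

Definition height (R : realType) (V : vectType R) (Pi : set V) (v : V) : R :=
  \sum_i coord (in_tuple (fset_set Pi)) i v.

Fact height_is_zmod_morphism (R : realType) (V : vectType R) (Pi : set V) :
  zmod_morphism (height Pi).
Proof. by move=> u v; rewrite /height -sumrB; apply: eq_bigr => i _; rewrite raddfB. Qed.

HB.instance Definition _ (R : realType) (V : vectType R) (Pi : set V) :=
  GRing.isZmodMorphism.Build V R (height Pi) (height_is_zmod_morphism Pi).

Section SimpleRoots.
Variables (R : realType) (V : vectType R) (ip : {dot V for idfun}).
Variables Delta Pi : set V.
Hypothesis rsD : root_system ip Delta.
Hypothesis sPi : simple_roots Delta Pi.
Implicit Types (a b x y : V).

Local Notation pos := (pos_roots Delta Pi).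

Lemma finite_simple : finite_set Pi.
Proof. exact: sub_finite_set (simple_root sPi) (root_finite rsD). Qed.

(** Linear independence of [Pi] enters here; the later arguments use it only through heights. *)
Lemma height_simple a : Pi a -> height Pi a = 1.
Proof.
move=> Pa; have aPi : a \in fset_set Pi by rewrite in_fset_set ?inE //; exact: finite_simple.
have fPi : free (in_tuple (fset_set Pi)) by exact: basis_free (simple_basis sPi).
have ia : (index a (fset_set Pi) < size (fset_set Pi))%N by rewrite index_mem.
have cE j : coord (in_tuple (fset_set Pi)) j a = (j == Ordinal ia)%:R.
  by rewrite eq_sym -(coord_free _ _ fPi) /= nth_index.
rewrite /height (bigD1 (Ordinal ia)) //= cE eqxx big1 ?addr0 // => j /negbTE jNi.
by rewrite cE jNi.
Qed.

Lemma nat_span_height_ge0 x : nat_span Pi x -> 0 <= height Pi x.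
Proof. by apply: nat_span_ge0 => a Pa /=; rewrite height_simple. Qed.

Lemma nat_span_subr x : nat_span Pi x -> x <> 0 ->
  exists2 a, Pi a & nat_span Pi (x - a).
Proof.
move=> [c ->] /eqP x0.
have [a aPi ca] : exists2 a, a \in fset_set Pi & (0 < c a)%N.
  apply/hasP; apply: contraNT x0 => /hasPn c0.
  by rewrite big_seq big1 // => a /c0; rewrite -eqn0Ngt => /eqP ->; rewrite mulr0n.
exists a; first exact: fset_set_subset.
exists (fun b => c b - (b == a))%N.
rewrite (bigD1_seq a) ?fset_uniq //= [RHS](bigD1_seq a) ?fset_uniq //= eqxx.
rewrite addrAC mulrnBr // mulr1n; congr (_ + _).
by apply: eq_bigr => b /negbTE ->; rewrite subn0.
Qed.

(** Removing one simple root leaves a combination of nonnegative height. *)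
Lemma nat_span_height_ge1 x : nat_span Pi x -> x <> 0 -> 1 <= height Pi x.
Proof.
move=> Px /(nat_span_subr Px)[a Pa /nat_span_height_ge0].
by rewrite raddfB /= (height_simple Pa) subr_ge0.
Qed.

Lemma nat_span_pointed x : nat_span Pi x -> nat_span Pi (- x) -> x = 0.
Proof.
move=> Px /nat_span_height_ge0; rewrite raddfN /= oppr_ge0 => hx.
apply: contrapT => /(nat_span_height_ge1 Px); lra.
Qed.

Lemma simple_indecomposable x y : Pi (x + y) -> nat_span Pi x -> nat_span Pi y ->
  x = 0 \/ y = 0.
Proof.
move=> /height_simple; rewrite raddfD /= => hxy Px Py.
apply: contrapT => /not_orP[/(nat_span_height_ge1 Px) ? /(nat_span_height_ge1 Py) ?].
lra.
Qed.

Lemma pos_root_neq0 a : pos a -> a <> 0.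
Proof. by move=> [/(root_nz rsD)/eqP]. Qed.

Lemma simple_pos_root a : Pi a -> pos a.
Proof.
by move=> Pa; split; [exact: (simple_root sPi)|apply: mem_nat_span => //; exact: finite_simple].
Qed.

Lemma opp_setE (S : set V) x : opp_set S x = S (- x).
Proof.
by apply/propext; split=> [[y Sy <-]|Sx]; [rewrite opprK | exists (- x); rewrite ?opprK].
Qed.

Lemma root_sign a : Delta a -> pos a \/ pos (- a).
Proof.
move=> Da; case: (simple_sign sPi Da) => [|]; first by left.
by rewrite opp_setE; right; split=> //; exact: rootN rsD _ Da.
Qed.

Lemma pos_rootN a : pos a -> ~ pos (- a).
Proof. by move=> pa [_ na]; apply: (pos_root_neq0 pa); apply: nat_span_pointed na; case: pa. Qed.

Lemma pos_root_sum a b : pos a -> pos b -> Delta (a + b) -> pos (a + b).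
Proof. by move=> [_ ?] [_ ?] ?; split=> //; exact: nat_spanD. Qed.

(** Since [ip b b > 0], some simple [a] has [ip b a > 0], so [b - a] is a root. It is positive:
    otherwise [a = b + (a - b)] would split a simple root. *)
Lemma pos_root_decomp b : pos b -> ~ Pi b ->
  exists x y, [/\ pos x, pos y & b = x + y].
Proof.
move=> pb nPb; have [Db [c bE]] := pb.
have [a aPi ab] : exists2 a, a \in fset_set Pi & 0 < ip b a.
  apply: contrapT => nex; have := ip_gt0 ip (root_nz rsD Db).
  rewrite {2}bE raddf_sum ltNge big_seq sumr_le0 //= => a aPi.
  rewrite raddfMn mulrn_wle0 // leNgt; apply/negP => ab; apply: nex; by exists a.
have /simple_pos_root pa := fset_set_subset aPi.
have nba : b != a.
  by apply/eqP => ba; apply: nPb; rewrite ba; exact: fset_set_subset.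
have Dba : Delta (b - a) by apply: (rootB rsD) => //; case: pa.
exists a, (b - a); split=> //; last by rewrite subrKC.
case: (root_sign Dba) => //; rewrite opprB => - [_ nab].
have Pba : Pi (b + (a - b)) by rewrite subrKC; exact: fset_set_subset.
have [b0|/eqP] := simple_indecomposable Pba (proj2 pb) nab.
  by case: (pos_root_neq0 pb).
by rewrite subr_eq0 eq_sym (negbTE nba).
Qed.

End SimpleRoots.

(** * The grading of the roots by the highest root *)

Section HighestRoot.
Variables (R : realType) (V : vectType R) (ip : {dot V for idfun}).
Variables (Delta Pi : set V) (theta : V).
Hypothesis rsD : root_system ip Delta.
Hypothesis sPi : simple_roots Delta Pi.
Hypothesis hth : highest_root Delta Pi theta.
Implicit Types (a b x y : V) (w : V -> V) (S : set V).

Local Notation pos := (pos_roots Delta Pi).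
Local Notation deg a := (ip a (coroot ip theta)).
Local Notation G := (graded ip Delta theta).

Lemma highest_rootE : Delta theta. Proof. exact: (proj1 hth). Qed.

Lemma highest_root_neq0 : theta != 0.
Proof. exact: root_nz rsD _ highest_rootE. Qed.

Lemma deg_theta : deg theta = 2.
Proof. exact: ip_coroot_self highest_root_neq0. Qed.

(** If [- theta] were positive, its height would be at least 1, while [theta - (- theta)] has
    nonnegative height because [theta] is highest. *)
Lemma highest_root_pos : pos theta.
Proof.
case: (root_sign rsD sPi highest_rootE) => // -[_ nth].
have := proj2 hth _ (rootN rsD highest_rootE); rewrite opprK.
move=> /(nat_span_height_ge0 rsD sPi).
have nth0 : - theta <> 0 by apply/eqP; rewrite oppr_eq0 highest_root_neq0.
have := nat_span_height_ge1 rsD sPi nth nth0.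
rewrite raddfN raddfD /=; lra.
Qed.

Lemma height_theta_gt0 : 0 < height Pi theta.
Proof.
apply: lt_le_trans ltr01 _; apply: (nat_span_height_ge1 rsD sPi).
  by case: highest_root_pos.
exact/eqP/highest_root_neq0.
Qed.

Lemma ip_theta_deg a : (0 < ip a theta) = (0 < deg a).
Proof.
have t0 := ip_gt0 ip highest_root_neq0.
by rewrite ip_coroot pmulr_lgt0 ?invr_gt0 // pmulr_rgt0.
Qed.

(** For [deg a < 0] the vector [theta + a] would be a root higher than [theta]. *)
Lemma deg_simple_ge0 a : Pi a -> 0 <= deg a.
Proof.
move=> Pa; rewrite leNgt; apply/negP => da.
have pa := simple_pos_root rsD sPi Pa; have Da : Delta a by case: pa.
have ta : Delta (theta - - a).
  apply: (rootB rsD highest_rootE (rootN rsD Da)).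
    by rewrite ipC ip_theta_deg linearNl oppr_gt0.
  apply/eqP => ta; case: (pos_rootN rsD sPi pa); rewrite -ta.
  exact: highest_root_pos.
have := nat_span_height_ge0 rsD sPi (proj2 hth _ ta).
by rewrite opprK opprD addNKr raddfN /= (height_simple rsD sPi Pa) oppr_ge0 ler10.
Qed.

Lemma deg_pos_ge0 a : pos a -> 0 <= deg a.
Proof.
case=> _; apply: (nat_span_ge0 (h := applyr ip (coroot ip theta))).
exact: deg_simple_ge0.
Qed.

(* For deg a = n >= 2, comparing heights in theta >= a and in
   theta >= - s_theta a = n theta - a leaves only n = 2 and a = theta. *)
Lemma deg_ge2_theta a (n : int) : Delta a -> deg a = n%:~R -> 2 <= n -> a = theta.
Proof.
move=> Da da n2.
have nta := proj2 hth _ Da.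
have nsa := proj2 hth _ (rootN rsD (root_reflection rsD highest_rootE Da)).
have := nat_span_height_ge0 rsD sPi nta.
have := nat_span_height_ge0 rsD sPi nsa.
have -> : theta - - reflection ip theta a = a - (n - 1)%:~R *: theta.
  by rewrite opprK /reflection da intrB scalerBl scale1r opprB addrCA.
rewrite !(raddfB (height Pi)) /=.
have h0 := height_theta_gt0.
have -> : height Pi ((n - 1)%:~R *: theta) = (n - 1)%:~R * height Pi theta.
  by rewrite scaler_int raddfMz /= mulrzl.
rewrite !subr_ge0 => h1 h2.
have n1 : (1 : R) <= (n - 1)%:~R by rewrite ler1z; lia.
have hE : height Pi (theta - a) = 0 by rewrite raddfB /=; nra.
apply/eqP; rewrite eq_sym -subr_eq0; apply/eqP; apply: contrapT => ta0.
by have := nat_span_height_ge1 rsD sPi nta ta0; rewrite hE ler10.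
Qed.

Lemma graded1_pos a : G 1 a -> pos a.
Proof.
move=> [Da da]; case: (root_sign rsD sPi Da) => // /deg_pos_ge0.
by rewrite linearNl /= da oppr_ge0 lern0.
Qed.

(** In degree 1 the reflection in [theta] sends [a] to [a - theta]. *)
Lemma graded1_compl a : G 1 a -> G 1 (theta - a).
Proof.
move=> [Da da]; split; last by rewrite linearBl /= da deg_theta; lra.
have := rootN rsD (root_reflection rsD highest_rootE Da).
by rewrite /reflection da scale1r opprB.
Qed.

(** Simple roots have degree at least 0, so only those of degree 0 can occur in [a]. This turns
    positivity of a difference of degree 0 into the order on Delta(1). *)
Lemma graded0_pos_span a : G 0 a -> pos a -> nat_span (Pi `&` G 0) a.
Proof.
move=> [Da da] [_ na].
have -> : Pi `&` G 0 = Pi `&` [set b | applyr ip (coroot ip theta) b = 0].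
  apply/seteqP; split=> b [Pb]; first by case.
  by move=> db; split=> //; split=> //; exact: (simple_root sPi).
apply: nat_span_face => //; [exact: finite_simple rsD sPi|exact: deg_simple_ge0].
Qed.

Lemma weyl0_graded0 w a : weyl0 ip Delta Pi theta w -> G 0 a -> pos (w a) -> pos a.
Proof.
move=> [Ww w0] [Da da] pwa; case: (root_sign rsD sPi Da) => // pna.
have := w0 (- a); rewrite (weylN _ Ww) => /(_ _)/(pos_rootN rsD sPi)[]; last by rewrite opprK.
by split=> //; split; [exact: rootN rsD _ Da | rewrite linearNl /= da oppr0].
Qed.

(** Used for monotonicity: if [b] is below [g] in Delta(1), then [w g - w b] is a nonnegative
    combination of simple roots. *)
Lemma weyl0_nat_span w x : weyl0 ip Delta Pi theta w ->
  nat_span (Pi `&` G 0) x -> nat_span Pi (w x).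
Proof.
move=> [Ww w0] [c ->]; rewrite (big_morph w (fun u v => weylD u v Ww) (weyl0E Ww)).
rewrite big_seq; apply: nat_span_sum => a /fset_set_subset[Pa Ga].
have pwa : nat_span Pi (w a).
  by apply: (proj2 (w0 a _)); split=> //; exact: simple_pos_root rsD sPi _ Pa.
elim: (c a) => [|n IHn]; first by rewrite mulr0n (weyl0E Ww); exact: nat_span0.
by rewrite mulrS (weylD _ _ Ww); apply: nat_spanD.
Qed.

(** * Minimal elements of the ideal attached to an element of W^0 *)

Definition pos_graded1 w : set V := [set a | G 1 a /\ pos (w a)].

(** The set [pos_graded1 w] is the ideal, by [setD_inversions]. The condition on [w theta] replaces
    the Lagrangian hypothesis, so that the lemma serves both [w] and [w] composed with the
    reflection in [theta]. *)
Lemma minimals_weyl0 w g : weyl0 ip Delta Pi theta w ->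
  (pos (w theta) ->
     exists2 a, pos_graded1 w a & pos_graded1 w (theta - a)) ->
  G 1 g ->
  minimals ip Delta Pi theta (pos_graded1 w) g <-> Pi (w g).
Proof.
move=> W0w wth Gg; have [Ww w0] := W0w; split; last first.
  move=> Pwg; split; first by split=> //; exact: simple_pos_root rsD sPi _ Pwg.
  (* A smaller [b] would split the simple root [w g] into [w b] and [w g - w b]. *)
  move=> b [Gb pwb] /(weyl0_nat_span W0w); rewrite (weylB _ _ Ww) => nwgb.
  have := simple_indecomposable (x := w b) (y := w g - w b) rsD sPi.
  rewrite subrKC => /(_ Pwg (proj2 pwb) nwgb)[/(pos_root_neq0 rsD pwb)//|/eqP].
  by rewrite subr_eq0 => /eqP/(weyl_inj rsD Ww).
move=> [[_ pwg] ming].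
(* The root [g - b] has degree 0; if [w] made it positive, it would be positive itself and [b] would
   lie strictly below [g]. *)
have below b : pos_graded1 w b -> b <> g -> Delta (g - b) -> ~ pos (w (g - b)).
  move=> Jb neq Dgb pwgb; apply: neq; apply: ming => //.
  have Ggb : G 0 (g - b).
    split=> //; rewrite linearBl /=; case: Gg => _ ->; case: Jb => -[_ ->] _.
    by rewrite subrr.
  exact: graded0_pos_span Ggb (weyl0_graded0 W0w Ggb pwgb).
apply: contrapT => /(pos_root_decomp rsD sPi pwg)[b1 [b2 [pb1 pb2 wgE]]].
have [m1 Dm1 m1E] := weyl_root_preimage rsD Ww (proj1 pb1).
have [m2 Dm2 m2E] := weyl_root_preimage rsD Ww (proj1 pb2).
have gE : g = m1 + m2 by apply: (weyl_inj rsD Ww); rewrite (weylD _ _ Ww) m1E m2E.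
have [_ dg] := Gg.
have /intrP[n1 n1E] := root_integral rsD highest_rootE Dm1.
have /intrP[n2 n2E] := root_integral rsD highest_rootE Dm2.
have n12 : n1 + n2 = 1.
  by apply: (@intr_inj R); rewrite intrD -n1E -n2E -linearDl /= -gE dg.
rewrite -m1E in pb1; rewrite -m2E in pb2.
wlog n21 : m1 m2 n1 n2 b1 b2 pb1 pb2 wgE m1E m2E Dm1 Dm2 gE n1E n2E n12 / n2 <= n1.
  move=> H; case: (lerP n2 n1) => n21; first exact: (H m1 m2 n1 n2 b1 b2).
  apply: (H m2 m1 n2 n1 b2 b1) => //; last exact: ltW.
  - by rewrite addrC.
  - by rewrite addrC.
  - by rewrite addrC.
(* The degrees satisfy [n1 + n2 = 1] and [n2 <= n1], so [n1] is at least 1. *)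
have [n1_1|n1_2] : n1 = 1 \/ 2 <= n1 by lia.
  have gm1 : g - m1 = m2 by rewrite gE addrC addKr.
  apply: (below m1); rewrite ?gm1 //.
    by split=> //; split=> //; rewrite n1E n1_1.
  move=> m1g; move: gm1; rewrite m1g subrr => m20.
  by have := root_nz rsD Dm2; rewrite -m20 eqxx.
have m1th := deg_ge2_theta Dm1 n1E n1_2; subst m1.
have [a Ja Jta] := wth pb1.
(* Now w g = w a + w (theta - a) + w m2 with all three roots positive, and g is
   not orthogonal to a + (theta - a) = theta. *)
have key b : pos_graded1 w b -> pos_graded1 w (theta - b) -> 0 < ip g b -> False.
  move=> Jb Jtb gb.
  have gbE : w (g - b) = w (theta - b) + w m2.
    by rewrite -(weylD _ _ Ww) gE addrAC.
  have neq : b <> g.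
    move=> bg; move: gbE; rewrite bg subrr (weyl0E Ww) => /esym/eqP.
    rewrite addr_eq0 => /eqP wtb; apply: (pos_rootN rsD sPi pb2).
    by rewrite -wtb -bg; case: Jtb.
  have Dgb : Delta (g - b).
    apply: (rootB rsD (proj1 Gg) _ gb); first by case: Jb => -[].
    by apply/eqP => /esym.
  apply: (below b Jb neq Dgb); rewrite gbE; apply: pos_root_sum => //.
    by case: Jtb.
  by rewrite -gbE; exact: weyl_root rsD _ _ Ww Dgb.
have gth : 0 < ip g a + ip g (theta - a).
  by rewrite -linearDr /= subrKC ip_theta_deg dg ltr01.
have [ga|ga] : 0 < ip g a \/ 0 < ip g (theta - a) by case: (ltP 0 (ip g a)); [left|right; lra].
  exact: key Ja Jta ga.
by apply: (key (theta - a)) => //; rewrite opprB subrKC.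
Qed.

(** * Lagrangian subsets and the involution [a |-> theta - a] *)

Lemma lagrangian_compl S : S `<=` G 1 ->
  (forall a, G 1 a -> S a <-> ~ S (theta - a)) -> lagrangian ip Delta theta S.
Proof.
move=> SG Sc.
have fG : finite_set (G 1).
  by apply: sub_finite_set (root_finite rsD) => a [].
have fS : finite_set S := sub_finite_set SG fG.
(* The involution carries [S] onto its complement, so [S] is half of Delta(1). *)
have SE : G 1 `\` S = (fun a => theta - a) @` S.
  apply/seteqP; split=> [a [Ga nSa]|_ [b Sb <-]].
    exists (theta - a); last by rewrite opprB subrKC.
    by apply/(Sc _ (graded1_compl Ga)); rewrite opprB subrKC.
  split; first exact: graded1_compl (SG _ Sb).
  exact/(Sc _ (SG _ Sb)).
split=> //; last first.
  move=> a b Sa Sb abE; apply: (proj1 (Sc a (SG _ Sa)) Sa).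
  by rewrite -abE addrC addKr.
have GE : G 1 = S `|` (G 1 `\` S) by rewrite setDUK.
have fT : finite_set (G 1 `\` S) by exact: finite_setD.
rewrite {1}GE fset_setU // cardfsU -fset_setI // setDIK fset_set0 cardfs0 subn0.
rewrite SE fset_set_image // card_imfset ?addnn //=.
by move=> x y /addrI/oppr_inj.
Qed.

Lemma non_lagrangian S : S `<=` G 1 -> ~ lagrangian ip Delta theta S ->
  exists2 a, G 1 a & (S a /\ S (theta - a)) \/ (~ S a /\ ~ S (theta - a)).
Proof.
move=> SG; apply: contra_notP => nex; apply: lagrangian_compl => // a Ga.
split=> [Sa Sta|nSta]; first by apply: nex; exists a => //; left.
by apply: contrapT => nSa; apply: nex; exists a => //; right.
Qed.

(** The reflection in [theta] fixes every root of degree 0. *)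
Lemma weyl0_comp_reflection_theta w : weyl0 ip Delta Pi theta w ->
  weyl0 ip Delta Pi theta (w \o reflection ip theta).
Proof.
move=> [Ww w0]; split; first exact: weyl_comp_reflection highest_rootE Ww.
move=> a Ga; rewrite /= /reflection; case: (Ga) => -[_ ->] _.
by rewrite scale0r subr0; exact: w0.
Qed.

Lemma reflection_theta_compl a : G 1 a -> reflection ip theta (theta - a) = - a.
Proof.
move=> /graded1_compl[_ da].
by rewrite /reflection da scale1r addrC addKr.
Qed.

Lemma setD_inversions w : weyl0 ip Delta Pi theta w ->
  G 1 `\` inversions Delta Pi w = pos_graded1 w.
Proof.
move=> [Ww _]; apply/seteqP; split=> a [Ga].
  move=> nNa; split=> //.
  case: (root_sign rsD sPi (weyl_root rsD Ww (proj1 Ga))) => // pnwa.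
  by case: nNa; split; [exact: graded1_pos | rewrite opp_setE].
by move=> pwa; split=> // -[_]; rewrite opp_setE; exact: pos_rootN rsD sPi _ _.
Qed.

End HighestRoot.

Theorem theorem4p4 (R : realType) (V : vectType R) (ip : {dot V for idfun})
    (Delta Pi : set V) (theta : V) (I : set V) (w : V -> V) :
  root_system ip Delta -> irreducible ip Delta ->
  simple_roots Delta Pi -> highest_root Delta Pi theta ->
  upper_ideal ip Delta Pi theta I ->
  weyl0 ip Delta Pi theta w ->
  graded ip Delta theta 1 `\` inversions Delta Pi w = I ->
  ((lagrangian ip Delta theta I ->
      opp_set (pos_roots Delta Pi) (w theta)) ->
    forall gamma, graded ip Delta theta 1 gamma ->
      (minimals ip Delta Pi theta I gamma <-> Pi (w gamma)))
  /\
  ((lagrangian ip Delta theta I -> pos_roots Delta Pi (w theta)) ->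
    forall gamma, graded ip Delta theta 1 gamma ->
      (maximals ip Delta Pi theta (graded ip Delta theta 1 `\` I) gamma <->
       opp_set Pi (w gamma))).
Proof.
move=> rsD _ sPi hth _ W0w; rewrite (setD_inversions rsD sPi hth W0w) => <-.
have [Ww _] := W0w.
have JG : pos_graded1 ip Delta Pi theta w `<=` graded ip Delta theta 1 by move=> a [].
have wsum a : w a + w (theta - a) = w theta by rewrite -(weylD _ _ Ww) subrKC.
have wthD : Delta (w theta) by apply: weyl_root rsD _ _ Ww (proj1 hth).
have sgn a : graded ip Delta theta 1 a -> ~ pos_graded1 ip Delta Pi theta w a ->
    pos_roots Delta Pi (- w a).
  move=> Ga nJa; case: (root_sign rsD sPi (weyl_root rsD Ww (proj1 Ga))) => // pwa.
  by case: nJa.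
split=> lag g Gg.
  apply: minimals_weyl0 => // pwth.
  have [] := non_lagrangian rsD hth JG.
    by move=> /lag; rewrite opp_setE; exact: pos_rootN rsD sPi _ _.
  move=> a Ga [[Ja Jta]|[nJa nJta]]; first by exists a.
  (* With both members of the pair outside the ideal, [w a] and [w (theta - a)] are negative, hence
     so is their sum [w theta]. *)
  case: (pos_rootN rsD sPi pwth); rewrite -(wsum a) opprD.
  apply: pos_root_sum; [exact: sgn|apply: sgn => //; exact: graded1_compl rsD hth _ _|].
  by rewrite -opprD wsum; exact: rootN rsD _ wthD.
(* The order-reversing involution a |-> theta - a of Delta(1) turns maximal
   elements for w into minimal elements for w s_theta. *)
set f := w \o reflection ip theta.
have fE a : graded ip Delta theta 1 a -> f (theta - a) = - w a.
  by move=> Ga; rewrite /f /= (reflection_theta_compl rsD hth Ga) (weylN _ Ww).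
have JfE a : graded ip Delta theta 1 a ->
    pos_graded1 ip Delta Pi theta f (theta - a) <->
    ~ pos_graded1 ip Delta Pi theta w a.
  move=> Ga; rewrite /pos_graded1 /= (fE _ Ga); split.
    by move=> [_ pn] [_ /(pos_rootN rsD sPi)].
  by move=> nJa; split; [exact: graded1_compl rsD hth _ _ | exact: sgn].
rewrite opp_setE -(fE _ Gg) -(minimals_weyl0 rsD sPi hth); last 3 first.
- exact: weyl0_comp_reflection_theta.
(* Here [f theta = - w theta] is positive. A pair inside the ideal would make [w theta] positive as
   well; a pair outside it becomes, by [JfE], the pair required for [f]. *)
- rewrite /f /= reflection_self ?(highest_root_neq0 rsD hth) // (weylN _ Ww) => pnwth.
  have [] := non_lagrangian rsD hth JG.
    by move=> /lag /(pos_rootN rsD sPi).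
  move=> a Ga [[[_ pa] [_ pta]]|[nJa nJta]].
    case: (pos_rootN rsD sPi _ pnwth); rewrite -(wsum a).
    by apply: pos_root_sum => //; rewrite wsum.
  exists (theta - a); first exact/JfE.
  by apply/JfE => //; exact: graded1_compl rsD hth _ _.
- exact: graded1_compl rsD hth _ _.
split=> -[].
  move=> [_ nJg] maxg; split; first exact/JfE.
  move=> b Jb; have Gb : graded ip Delta theta 1 b by case: Jb.
  have bE : theta - (theta - b) = b by rewrite opprB subrKC.
  (* The relations [b] below [theta - g] and [g] below [theta - b] concern the same difference. *)
  rewrite /root_le addrAC => le; rewrite -(maxg (theta - b)) //.
    split; first exact: graded1_compl rsD hth _ _.
    by apply/JfE; [exact: graded1_compl rsD hth _ _ | rewrite bE].
move=> Jg ming; split; first by split=> //; apply/JfE.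
move=> b [Gb nJb] le; apply: oppr_inj; apply: (addrI theta).
apply: ming; first exact/JfE.
by rewrite /root_le opprB addrC addrA subrK.
Qed.
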